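(* Let $n$ be a positive integer with $n\equiv 0\pmod 4$. Fix any Type III code $C$ of length $n$ and, for $0\le k\le \frac n2$, let $L_k^{\mathrm{III}}(n)$ be the number of Type III codes of length $n$ that are $k$-neighbors of $C$. Then the number of Type III codes of length $n$ is $$\sum_{k=0}^{n/2} L_k^{\mathrm{III}}(n).$$
   Context: Equip $\mathbb{F}_3^n$ with the inner product $u\cdot v=\sum_{i=1}^n u_iv_i$. A code of length $n$ over $\mathbb{F}_3$ is a linear subspace $C\subseteq\mathbb{F}_3^n$; its dual is $C^\perp=\{v\in\mathbb{F}_3^n : u\cdot v=0 \text{ for all } u\in C\}$, and $C$ is self-dual if $C=C^\perp$ (so $\dim C=n/2$). The weight of a vector is its number of nonzero coordinates. A Type III code is a self-dual code over $\mathbb{F}_3$ in which every codeword has weight divisible by $3$. Codes are counted as subspaces (not up to equivalence). For $0\le k\le n/2$, two self-dual codes $C,D$ of length $n$ are $k$-neighbors if $\dim(C\cap D)=\frac n2-k$ (in particular, the only $0$-neighbor of $C$ is $C$ itself). *)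

(* Defs.v *)
From HB Require Import structures.
From mathcomp Require Import all_boot all_algebra.

Set Implicit Arguments.
Unset Strict Implicit.
Unset Printing Implicit Defensive.

Import GRing.Theory VectorInternalTheory.

(* MathComp gives {vspace vT} only a choiceType structure.  Over a finite field
   it is a subtype of a finite matrix type (the canonical generator matrices),
   hence a finType, so that sets of codes can be counted as subspaces. *)
HB.instance Definition _ (K : finFieldType) (vT : vectType K) :=
  [Countable of {vspace vT} by <:].
HB.instance Definition _ (K : finFieldType) (vT : vectType K) :=
  [Finite of {vspace vT} by <:].

Notation code n := {vspace 'rV['F_3]_n}.

Definition dot (n : nat) (u v : 'rV['F_3]_n) : 'F_3 :=
  (\sum_(i < n) u 0 i * v 0 i)%R.

(* [dot u] as a map into the one-dimensional 'F_3-space, so that its kernel is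
   a code. *)
Definition dotl (n : nat) (u v : 'rV['F_3]_n) : ('F_3)^o := dot u v.

Fact dotl_is_linear (n : nat) (u : 'rV['F_3]_n) : linear (dotl u).
Proof.
move=> a v w; rewrite /dotl /dot /= scaler_sumr -big_split /=.
apply: eq_bigr => i _; rewrite !mxE mulrDr; congr (_ + _)%R.
by rewrite mulrCA.
Qed.

HB.instance Definition _ (n : nat) (u : 'rV['F_3]_n) :=
  GRing.isLinear.Build 'F_3 'rV['F_3]_n ('F_3)^o _ (dotl u) (dotl_is_linear u).

Definition dual_code (n : nat) (C : code n) : code n :=
  (\bigcap_(u in C) lker (linfun (dotl u)))%VS.

Lemma dual_codeP (n : nat) (C : code n) (v : 'rV['F_3]_n) :
  reflect (forall u, u \in C -> dot u v = 0%R) (v \in dual_code C).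
Proof.
rewrite memvE; apply: (iffP subv_bigcapP) => h u uC.
  by have := h u uC; rewrite -memvE memv_ker lfunE => /eqP.
by rewrite -memvE memv_ker lfunE; apply/eqP/h.
Qed.

Definition self_dual (n : nat) (C : code n) : bool := C == dual_code C.

Definition weight (n : nat) (v : 'rV['F_3]_n) : nat :=
  #|[set i : 'I_n | v 0%R i != 0%R]|.

Definition typeIII (n : nat) (C : code n) : bool :=
  self_dual C && [forall v in C, 3 %| weight v].

(* The bound on k makes the subtraction on nat exact. *)
Definition neighbors (n k : nat) (C D : code n) : bool :=
  [&& k <= n./2, self_dual C, self_dual D & \dim (C :&: D) == n./2 - k].

Definition L_III (n : nat) (C : code n) (k : nat) : nat :=
  #|[set D : code n | typeIII D & neighbors k C D]|.

(* Main.v *)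
Require Import Defs.
From mathcomp Require Import all_boot all_algebra.

(** Every Type III code [D] is a [k]-neighbor of [C] for exactly one
    [k <= n/2], namely [k = n/2 - \dim (C :&: D)], so sorting the Type III codes
    by this number splits them into the classes that the sum counts.  On [nat]
    the subtraction is truncated, and [k] recovers the dimension of the
    intersection only if that dimension is at most [n/2].  This bound is the one
    coding-theoretic input ([dim_self_dual_le]): a generator matrix [G] of a
    self-dual code satisfies [G *m G^T = 0], and two matrices with zero product
    have ranks that add up to at most their common dimension [n]. *)

Definition generator_mx {n : nat} (C : code n) : 'M['F_3]_(\dim C, n) :=
  (\matrix_(i < \dim C) (vbasis C)`_i)%R.

Lemma generator_mx_row_free {n : nat} (C : code n) : row_free (generator_mx C).
Proof.
apply: inj_row_free => v v0; apply/rowP => i; rewrite mxE.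
have /freeP vbasis_free := basis_free (vbasisP C).
apply: (vbasis_free (v 0%R)) i.
rewrite -[RHS]v0 mulmx_sum_row.
by apply: eq_bigr => j _; rewrite rowK.
Qed.

Lemma generator_mx_orthogonal {n : nat} (C : code n) :
  self_dual C -> (generator_mx C *m (generator_mx C)^T = 0)%R.
Proof.
move=> /eqP CE; apply/matrixP => i j; rewrite mxE [RHS]mxE.
have basis_in (l : 'I_(\dim C)) : ((vbasis C)`_l)%R \in C.
  by apply: vbasis_mem; rewrite mem_nth // size_tuple.
have : ((vbasis C)`_j)%R \in dual_code C by rewrite -CE.
move=> /dual_codeP /(_ _ (basis_in i)) dot0; rewrite -[RHS]dot0.
by apply: eq_bigr => k _; rewrite !mxE.
Qed.

Lemma dim_self_dual_le {n : nat} (C : code n) : self_dual C -> \dim C <= n./2.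
Proof.
move=> /generator_mx_orthogonal /mulmx0_rank_max.
have /eqP rank_gen := generator_mx_row_free C.
by rewrite mxrank_tr rank_gen addnn geq_half_double.
Qed.

(** The bound on the dimension of [C] makes both truncated subtractions exact,
    which is why the distance determines [k]. *)
Lemma neighborsE {n k : nat} (C D : code n) :
  k <= n./2 -> self_dual C -> self_dual D ->
  neighbors k C D = (n./2 - \dim (C :&: D) == k).
Proof.
move=> le_k C_sd D_sd; rewrite /neighbors le_k C_sd D_sd /=.
have le_cap : \dim (C :&: D) <= n./2.
  by apply: leq_trans (dim_self_dual_le _ C_sd); apply/dimvS/capvSl.
by apply/eqP/eqP => [->|<-]; rewrite subKn.
Qed.

Theorem theorem3p16 (n : nat) (n_gt0 : 0 < n) (n_mod4 : n = 0 %[mod 4])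
    (C : code n) (C_III : typeIII C) :
  #|[set D : code n | typeIII D]| = \sum_(0 <= k < n./2.+1) L_III C k.
Proof.
have /andP[C_sd _] := C_III.
pose distance (D : code n) : 'I_n./2.+1 := inord (n./2 - \dim (C :&: D)).
rewrite big_mkord -sum1_card (partition_big distance xpredT) //=.
apply: eq_bigr => k _; rewrite /L_III -sum1_card.
apply: eq_bigl => D; rewrite !inE; case D_III: (typeIII D) => //=.
have /andP[D_sd _] := D_III.
have le_k : k <= n./2 by rewrite -ltnS.
by rewrite (neighborsE _ _ le_k C_sd D_sd) -val_eqE /= inordK // ltnS leq_subr.
Qed.
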